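(* Let $k\ge 3$ be an integer, and let $H$ be the $k$-centipede. (1) $\left(\lceil k/2\rceil+1\right)K_2$ is a linear forest minimal $H$-obstruction of minimum order. (2) If $k=3r$ for some integer $r$, then $rP_4+K_2$ is a linear forest minimal $H$-obstruction of maximum order. (3) If $k=3r+1$ for some integer $r$, then $(r+1)P_4$ is a linear forest minimal $H$-obstruction of maximum order. (4) If $k=3r+2$ for some integer $r$, then $rP_4+2K_2$ is a linear forest minimal $H$-obstruction of maximum order.
   Context: Graphs are finite and undirected, with neither loops nor parallel edges. $P_n$ and $K_n$ are the path and complete graph on $n$ vertices, $+$ is disjoint union and $nG$ is the disjoint union of $n$ copies of $G$. A full homomorphism from $G$ to $H$ is a function $\varphi\colon V_G\to V_H$ such that, for all $u,v\in V_G$, $uv\in E_G$ if and only if $\varphi(u)\varphi(v)\in E_H$. A minimal $H$-obstruction is a graph that admits no full homomorphism to $H$ but all of whose proper induced subgraphs do. A linear forest is a graph each of whose components is a path; a linear forest minimal $H$-obstruction is a minimal $H$-obstruction that is a linear forest, and ''of minimum (maximum) order'' means having the least (greatest) number of vertices among all linear forest minimal $H$-obstructions. The $k$-centipede is the tree on $2k$ vertices obtained from a path on $k$ vertices by attaching exactly one leaf to every vertex of the path. *)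

(* Defs.v *)
From mathcomp Require Import all_boot.

Set Implicit Arguments.
Unset Strict Implicit.
Unset Printing Implicit Defensive.

Record sgraph := SGraph {
  svertex :> finType;
  sedge : rel svertex;
  sedge_sym : symmetric sedge;
  sedge_irrefl : irreflexive sedge
}.

Section Path.
Variable n : nat.

Definition path_edge : rel 'I_n := fun i j =>
  (i.+1 == j :> nat) || (j.+1 == i :> nat).

Lemma path_edge_sym : symmetric path_edge.
Proof. by move=> i j; rewrite /path_edge orbC. Qed.

Lemma path_edge_irrefl : irreflexive path_edge.
Proof. by move=> i; rewrite /path_edge orbb gtn_eqF. Qed.

Definition path_graph : sgraph := SGraph path_edge_sym path_edge_irrefl.

End Path.

Section Complete.
Variable n : nat.

Definition complete_edge : rel 'I_n := fun i j => i != j.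

Lemma complete_edge_sym : symmetric complete_edge.
Proof. by move=> i j; rewrite /complete_edge eq_sym. Qed.

Lemma complete_edge_irrefl : irreflexive complete_edge.
Proof. by move=> i; rewrite /complete_edge eqxx. Qed.

Definition complete_graph : sgraph :=
  SGraph complete_edge_sym complete_edge_irrefl.

End Complete.

Section Centipede.
Variable k : nat.

(* [inl i] is the i-th vertex of the spine and [inr i] is its leaf. *)
Definition centipede_edge : rel ('I_k + 'I_k)%type := fun u v =>
  match u, v with
  | inl i, inl j => path_edge i j
  | inl i, inr j | inr i, inl j => i == j
  | inr _, inr _ => false
  end.

Lemma centipede_edge_sym : symmetric centipede_edge.
Proof. by case=> i [] j //=; rewrite (path_edge_sym, eq_sym). Qed.

Lemma centipede_edge_irrefl : irreflexive centipede_edge.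
Proof. by case=> i //; apply: path_edge_irrefl. Qed.

Definition centipede : sgraph :=
  SGraph centipede_edge_sym centipede_edge_irrefl.

End Centipede.

Section DisjointUnion.
Variables G1 G2 : sgraph.

Definition disjoint_union_edge : rel (G1 + G2)%type := fun u v =>
  match u, v with
  | inl x, inl y => sedge x y
  | inr x, inr y => sedge x y
  | _, _ => false
  end.

Lemma disjoint_union_edge_sym : symmetric disjoint_union_edge.
Proof. by case=> x [] y //=; rewrite sedge_sym. Qed.

Lemma disjoint_union_edge_irrefl : irreflexive disjoint_union_edge.
Proof. by case=> x; apply: sedge_irrefl. Qed.

Definition disjoint_union : sgraph :=
  SGraph disjoint_union_edge_sym disjoint_union_edge_irrefl.

End DisjointUnion.

Section Copies.
Variables (n : nat) (G : sgraph).

Definition copies_edge : rel ('I_n * G)%type := fun u v =>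
  (u.1 == v.1) && sedge u.2 v.2.

Lemma copies_edge_sym : symmetric copies_edge.
Proof. by move=> u v; rewrite /copies_edge eq_sym sedge_sym. Qed.

Lemma copies_edge_irrefl : irreflexive copies_edge.
Proof. by move=> u; rewrite /copies_edge sedge_irrefl andbF. Qed.

Definition copies : sgraph := SGraph copies_edge_sym copies_edge_irrefl.

End Copies.

Section Induced.
Variables (G : sgraph) (A : {set G}).

Definition induced_edge : rel {x : G | x \in A} := fun u v =>
  sedge (val u) (val v).

Lemma induced_edge_sym : symmetric induced_edge.
Proof. by move=> u v; apply: sedge_sym. Qed.

Lemma induced_edge_irrefl : irreflexive induced_edge.
Proof. by move=> u; apply: sedge_irrefl. Qed.

Definition induced : sgraph := SGraph induced_edge_sym induced_edge_irrefl.

End Induced.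

Definition full_hom (G H : sgraph) : Prop :=
  exists f : G -> H, forall u v : G, sedge u v <-> sedge (f u) (f v).

Definition isomorphic (G H : sgraph) : Prop :=
  exists2 f : G -> H,
    bijective f & forall u v : G, sedge u v <-> sedge (f u) (f v).

Definition component (G : sgraph) (x : G) : {set G} :=
  [set y | connect (@sedge G) x y].

Definition linear_forest (G : sgraph) : Prop :=
  forall x : G, exists n : nat, isomorphic (induced (component x)) (path_graph n).

Definition minimal_obstruction (H G : sgraph) : Prop :=
  ~ full_hom G H /\
  forall A : {set G}, A \proper [set: G] -> full_hom (induced A) H.

Definition linear_forest_minimal_obstruction (H G : sgraph) : Prop :=
  linear_forest G /\ minimal_obstruction H G.

Definition minimum_order_linear_forest_minimal_obstruction
    (H G : sgraph) : Prop :=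
  linear_forest_minimal_obstruction H G /\
  forall G' : sgraph,
    linear_forest_minimal_obstruction H G' -> #|G| <= #|G'|.

Definition maximum_order_linear_forest_minimal_obstruction
    (H G : sgraph) : Prop :=
  linear_forest_minimal_obstruction H G /\
  forall G' : sgraph,
    linear_forest_minimal_obstruction H G' -> #|G'| <= #|G|.

(* Main.v *)
Require Import Defs.
From mathcomp Require Import all_boot zify.

Set Implicit Arguments.
Unset Strict Implicit.
Unset Printing Implicit Defensive.

(** Index the columns of the centipede by the spine: column [t] consists of the
    spine vertex [t] and its leaf.  In a full homomorphism from a linear forest
    to the centipede, a path with at least one edge meets some set of spine
    vertices, and two such paths must leave an unused spine vertex between
    them, for otherwise an edge would join their images.  Charging to each path
    the spine vertices that it uses together with the next one, the [k] spine
    vertices and one virtual vertex after the last give a budget of [k + 1].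

    The price of a path on [n] vertices is [path_cost n]: an edge costs 2, a
    path with [n >= 3] costs [n - 1] (its two ends can be put on leaves, and for
    [n = 3] the two ends are twins and share a leaf), and an isolated vertex
    costs nothing.  The budget is necessary ([full_hom_total_cost]) and, laying
    the paths greedily from left to right, also sufficient; the only exception
    is that an isolated vertex needs the leaf of an unused spine vertex, and
    there is none when a single path exhausts the budget
    ([full_hom_centipede]).

    Let the paths of a minimal obstruction have lengths [s].  Either the
    budget is exceeded or [s] is that exception, an isolated vertex and a path on
    [k + 2] vertices, of order [k + 3].  In the first case every vertex deletion
    must lower the price.  This rules out lengths 1, 3 and 5, since deleting the
    middle vertex of [P_5] leaves two edges, again of price 4.  Deleting an end
    of a path on at least 4 vertices lowers the price by 1 only, so the price is
    exactly [k + 2] unless all paths are edges, in which case it may be [k + 3]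
    ([minimal_obstruction_lengths]).

    The order of such a forest exceeds its price by the number of its paths on
    at least 4 vertices.  The order is therefore least when there are only
    edges, up to the parity of [k].  It is greatest when there are as many paths
    [P_4], of price 3, as possible; when [k + 2] is 1 modulo 3, length 5 being
    excluded, one path [P_4] less than the quotient suggests fits, and two edges
    make up the price. *)

(** * Linear forests in coordinates *)

Definition adjacent_pos (y z : nat * nat) : bool :=
  (y.1 == z.1) && ((y.2.+1 == z.2) || (z.2.+1 == y.2)).

(** [layout s p] identifies [G] with the disjoint union of paths whose numbers of
    vertices are the entries of [s]: [p u] is the index of the path of [u] paired
    with the position of [u] on it.  Entries equal to 0 are allowed and stand for
    no path at all. *)
Record layout (s : seq nat) (G : sgraph) (p : G -> nat * nat) : Prop := Layout {
  layout_inj : injective p;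
  layout_lt : forall u, (p u).2 < nth 0 s (p u).1;
  layout_onto : forall i j, j < nth 0 s i -> exists u, p u = (i, j);
  layout_edge : forall u v, sedge u v = adjacent_pos (p u) (p v)
}.

Lemma nth_gt_size (s : seq nat) i j : j < nth 0 s i -> i < size s.
Proof. by move=> h; rewrite ltnNge; apply/negP => /(nth_default 0) e; rewrite e in h. Qed.

Lemma card_layout s (G : sgraph) (p : G -> nat * nat) :
  layout s p -> #|G| = sumn s.
Proof.
case=> inj lt onto _.
pose S := [seq (i, j) | i <- iota 0 (size s), j <- iota 0 (nth 0 s i)].
have uS : uniq S.
  apply: allpairs_uniq_dep; first exact: iota_uniq.
    by move=> *; apply: iota_uniq.
  by move=> [i j] [i' j'] _ _ /= [-> ->].
have memS y : (y \in S) = (y.2 < nth 0 s y.1).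
  apply/allpairsPdep/idP => [[i [j [_ hj ->]]]|h] /=.
    by move: hj; rewrite mem_iota.
  by case: y h => i j /= h; exists i, j; rewrite !mem_iota (nth_gt_size h).
have /perm_size : perm_eq (map p (enum G)) S.
  apply: uniq_perm => //; first by rewrite map_inj_uniq // enum_uniq.
  move=> [i j]; rewrite memS; apply/mapP/idP => [[u _ ->]|]; first exact: lt.
  by case/onto=> u <-; exists u; rewrite // mem_enum.
rewrite size_map -cardE => ->; rewrite size_allpairs_dep.
rewrite (eq_map (fun i => size_iota 0 (nth 0 s i))).
by congr sumn; apply: (@eq_from_nth _ 0); rewrite size_map size_iota // => i hi;
  rewrite (nth_map 0) ?size_iota // nth_iota.
Qed.

(** Each component is indexed by the rank of its root among all the vertices; a
    vertex that is not a root gets length 0, which spares a renumbering. *)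
Lemma linear_forest_layout (G : sgraph) :
  linear_forest G -> exists s, exists p : G -> nat * nat, layout s p.
Proof.
move=> lf.
have csym : connect_sym (@sedge G) by apply: sym_connect_sym; apply: sedge_sym.
have /fin_all_exists [n /fin_all_exists [g gP]] : forall x : G, exists n,
    exists g : G -> nat,
    [/\ {in component x &, injective g}, {in component x, forall u, g u < n},
        forall j, j < n -> exists2 u, u \in component x & g u = j
      & {in component x &, forall u v,
          sedge u v = (((g u).+1 == g v) || ((g v).+1 == g u))}].
  move=> x; have [n [h bij he]] := lf x; exists n.
  have hE u (ux : u \in component x) :
      (if insub u is Some w then nat_of_ord (h w) else 0) = h (Sub u ux).
    by rewrite insubT.
  exists (fun u => if insub u is Some w then nat_of_ord (h w) else 0).
  split=> [u v ux vx|u ux|j jn|u v ux vx].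
  - by rewrite (hE u ux) (hE v vx) => /val_inj/(bij_inj bij)/(congr1 val).
  - by rewrite (hE u ux) ltn_ord.
  - have [h' _ hK'] := bij; exists (val (h' (Ordinal jn))); first exact: valP.
    by rewrite valK hK'.
  - rewrite (hE u ux) (hE v vx).
    have [h1 h2] := he (Sub u ux) (Sub v vx).
    by apply/idP/idP; [exact: h1 | exact: h2].
pose r := root (@sedge G).
have rin u : u \in component (r u) by rewrite inE csym connect_root.
have rr u : r (r u) = r u by apply: root_root.
have req u v : u \in component (r v) -> r u = r v.
  by rewrite inE => /(rootP csym) h; rewrite -(rr v); apply: esym h.
pose s := [seq (if r x == x then n x else 0) | x <- enum G].
pose p u := (index (r u) (enum G), g (r u) u).
have nths x : nth 0 s (index x (enum G)) = if r x == x then n x else 0.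
  by rewrite (nth_map x) ?index_mem ?mem_enum // nth_index ?mem_enum.
have idx u v : index u (enum G) = index v (enum G) -> u = v.
  by move=> h; rewrite -(nth_index u (mem_enum G u)) h nth_index ?mem_enum.
exists s, p; split.
- move=> u v [/idx ruv]; rewrite -ruv.
  by case: (gP (r u)) => inj _ _ _ /inj; apply; rewrite // ruv.
- by move=> u; rewrite /= nths rr eqxx; case: (gP (r u)) => _ lt _ _; apply: lt.
- move=> i j jn; have := nth_gt_size jn; rewrite size_map => iG.
  have [x0 _] : exists x0 : G, x0 \in enum G.
    by move: iG; case: (enum G) => // x0 ? _; exists x0; rewrite inE eqxx.
  pose x := nth x0 (enum G) i.
  have ix : i = index x (enum G) by rewrite index_uniq ?enum_uniq.
  move: jn; rewrite ix nths; case: eqP => // rx jn.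
  case: (gP x) => _ _ /(_ j jn) [u ux gu] _; exists u; rewrite /p.
  have ru : r u = x by rewrite -rx; apply: req; rewrite rx.
  by rewrite ru gu.
- move=> u v; rewrite /adjacent_pos /=; case: eqP => [/idx ruv|nruv] /=.
    by rewrite -ruv; case: (gP (r u)) => _ _ _; apply; rewrite // ruv.
  apply/negP => /connect1/(rootP csym) ruv; apply: nruv.
  by rewrite /r ruv.
Qed.

Lemma layout_linear_forest s (G : sgraph) (p : G -> nat * nat) :
  layout s p -> linear_forest G.
Proof.
move=> [inj lt onto edge] x.
have csym : connect_sym (@sedge G) by apply: sym_connect_sym; apply: sedge_sym.
have conn0 j u v : p u = ((p v).1, 0) -> p v = ((p v).1, j) ->
    connect (@sedge G) u v.
  elim: j v => [|j IH] v pu pv; first by rewrite (inj u v) ?connect0 // pu -pv.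
  have := lt v; rewrite {1}pv /= => /ltnW/onto [w pw].
  apply: (connect_trans (IH w _ _)); rewrite ?pw //.
  by apply: connect1; rewrite edge pw pv /adjacent_pos /= !eqxx.
have comp y : (y \in component x) = ((p y).1 == (p x).1).
  rewrite inE; apply/idP/eqP => [|e].
    case/connectP => q; elim: q x => [|z q IH] x' /= => [_ -> //|].
    by case/andP; rewrite edge => /andP[/eqP -> _] /IH h /h.
  have /(leq_ltn_trans (leq0n _))/onto [w pw] := lt x.
  have wx : connect (@sedge G) w x.
    by apply: (conn0 (p x).2) => //; case: (p x).
  have wy : connect (@sedge G) w y.
    by apply: (conn0 (p y).2); rewrite ?pw -?e //; case: (p y).
  by apply: connect_trans wy; rewrite csym.
exists (nth 0 s (p x).1).
have lt' (w : induced (component x)) : (p (val w)).2 < nth 0 s (p x).1.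
  by have := valP w; rewrite comp => /eqP <-.
have hx (w : induced (component x)) : (p (val w)).1 = (p x).1.
  by have := valP w; rewrite comp => /eqP.
have /fin_all_exists [h hP] : forall j : 'I_(nth 0 s (p x).1),
    exists w : induced (component x), (p (val w)).2 = j.
  move=> j; have [u pu] := onto _ _ (ltn_ord j).
  have ux : u \in component x by rewrite comp pu.
  by exists (Sub u ux); rewrite /= pu.
exists (fun w => Ordinal (lt' w)).
  exists h => [w|j]; last by apply: val_inj; rewrite /= hP.
  apply/val_inj/inj; rewrite [LHS]surjective_pairing [RHS]surjective_pairing.
  by rewrite !hx hP.
by move=> u v; rewrite /= /induced_edge edge /adjacent_pos !hx eqxx.
Qed.

Lemma layout_path n :
  layout [:: n] (fun u : path_graph n => (0, nat_of_ord u)).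
Proof.
split=> [u v [/val_inj]|u|i j|u v]//=.
by case: i => [|i] //= jn; [exists (Ordinal jn) | rewrite nth_nil in jn].
Qed.

Lemma layout_complete2 :
  layout [:: 2] (fun u : complete_graph 2 => (0, nat_of_ord u)).
Proof.
split=> [u v [/val_inj]|u|i j|u v] //=.
  by case: i => [|i] //= jn; [exists (Ordinal jn) | rewrite nth_nil in jn].
by case: u v => [[|[|?]] ?] [[|[|?]] ?].
Qed.

Lemma layout_copies r n (G : sgraph) (p : G -> nat * nat) :
  layout [:: n] p ->
  layout (nseq r n) (fun u : copies r G => (nat_of_ord u.1, (p u.2).2)).
Proof.
case=> inj lt onto edge.
have p0 u : (p u).1 = 0 by have := lt u; case: (p u) => -[|[|?]] ?.
split=> [[i x] [j y] /= [/val_inj -> e]|[i x]|i j|[i x] [j y]] /=.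
- congr pair; apply: inj.
  by rewrite [LHS]surjective_pairing [RHS]surjective_pairing !p0 e.
- by rewrite nth_nseq ltn_ord; have := lt x; rewrite p0.
- rewrite nth_nseq; case: ifP => // ir jn.
  by case: (onto 0 j jn) => u pu; exists (Ordinal ir, u); rewrite /= pu.
- by rewrite /copies_edge /= edge /adjacent_pos /= !p0.
Qed.

Lemma layout_disjoint_union s1 s2 (G1 G2 : sgraph)
    (p1 : G1 -> nat * nat) (p2 : G2 -> nat * nat) :
  layout s1 p1 -> layout s2 p2 ->
  layout (s1 ++ s2) (fun u : disjoint_union G1 G2 =>
    match u with
    | inl x => p1 x
    | inr y => (size s1 + (p2 y).1, (p2 y).2)
    end).
Proof.
case=> inj1 lt1 onto1 edge1 [inj2 lt2 onto2 edge2].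
have sz1 x : (p1 x).1 < size s1 := nth_gt_size (lt1 x).
split=> [[x|x] [y|y]|[x|x]|i j|[x|x] [y|y]] /=.
- by move/inj1->.
- by move=> e; have := sz1 x; rewrite e /=; lia.
- by move=> e; have := sz1 y; rewrite -e /=; lia.
- case=> e1 e2; congr inr; apply: inj2.
  by rewrite [LHS]surjective_pairing [RHS]surjective_pairing e2; congr pair; lia.
- by rewrite nth_cat sz1.
- by rewrite nth_cat ifN ?addKn // -leqNgt leq_addr.
- rewrite nth_cat; case: (ltnP i (size s1)) => h.
    by move/onto1 => [u pu]; exists (inl u).
  by move/onto2 => [u pu]; exists (inr u); rewrite pu subnKC.
- exact: edge1.
- by rewrite /adjacent_pos /=; have := sz1 x; lia.
- by rewrite /adjacent_pos /=; have := sz1 y; lia.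
- by rewrite edge2 /adjacent_pos /= eqn_add2l.
Qed.

(** * Deleting a vertex from a linear forest *)

(** Deleting position [a] of path [m] leaves the positions below [a] in place and
    moves those above it to a new path, of index [l]. *)
Definition cut_pos (m a l : nat) (y : nat * nat) : nat * nat :=
  if (y.1 == m) && (a < y.2) then (l, y.2 - a.+1) else y.

Lemma layout_delete s1 a b s2 (G : sgraph) (p : G -> nat * nat) (v : G) :
  layout (s1 ++ (a + b).+1 :: s2) p -> p v = (size s1, a) ->
  layout (rcons (s1 ++ a :: s2) b)
    (fun u : induced [set~ v] =>
       cut_pos (size s1) a (size (s1 ++ a :: s2)) (p (val u))).
Proof.
case=> inj lt onto edge pv; set l := size (s1 ++ a :: s2).
have lE : l = (size s1 + size s2).+1 by rewrite /l size_cat /= addnS.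
have neq (u : induced [set~ v]) : p (val u) != (size s1, a).
  apply/eqP => e; have := valP u; rewrite !inE -pv in e *.
  by rewrite (inj _ _ e) eqxx.
have lt_l u : (p u).1 < l.
  by have /nth_gt_size := lt u; rewrite size_cat /= lE addnS.
have nthl i : i != size s1 ->
    nth 0 (rcons (s1 ++ a :: s2) b) i =
    if i == l then b else nth 0 (s1 ++ (a + b).+1 :: s2) i.
  move=> im; rewrite nth_rcons -/l !nth_cat; case: (ltngtP i l) => // il; last first.
    by case: ltnP => h; [lia|rewrite nth_default //= ; lia].
  case: ltnP => // mi; have: i - size s1 != 0 by lia.
  by case: (i - size s1).
have nthm (s : seq nat) c : nth 0 (s1 ++ c :: s) (size s1) = c.
  by rewrite nth_cat ltnn subnn.
have nthm' : nth 0 (rcons (s1 ++ a :: s2) b) (size s1) = a.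
  by rewrite nth_rcons nthm size_cat /= addnS ltnS leq_addr.
split.
- move=> u v' /= e; apply/val_inj/inj; move: e.
  have := lt_l (val u); have := lt_l (val v'); rewrite /cut_pos.
  case: (p (val u)) (p (val v')) => [i j] [i' j'] /=.
  by case: ifP; case: ifP => h1 h2 l1 l2 /eqP; rewrite xpair_eqE => e;
    apply/eqP; rewrite xpair_eqE; lia.
- move=> u; have := lt (val u); have := neq u; have := lt_l (val u).
  rewrite /cut_pos; case: (p (val u)) => i j /= il.
  rewrite xpair_eqE; case: (eqVneq i (size s1)) => [->|im] /=.
    rewrite nthm; case: (ltnP a j) => /= h nj jn; last by rewrite nthm'; lia.
    rewrite nthl ?eqxx; lia.
  by rewrite nthl //; case: eqP => //; lia.
- move=> i j jn.
  have [u pu] : exists u : G, p u != (size s1, a) /\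
      cut_pos (size s1) a l (p u) = (i, j).
    move: jn; case: (eqVneq i (size s1)) => [->|im].
      rewrite nthm' => ja; case: (onto (size s1) j); first by rewrite nthm; lia.
      move=> u pu; exists u; rewrite pu /cut_pos /= xpair_eqE eqxx /=.
      by split; [lia | case: ltnP => //; lia].
    rewrite nthl //; case: eqP => [->|/eqP il] jn.
      case: (onto (size s1) (j + a.+1)); first by rewrite nthm; lia.
      move=> u pu; exists u; rewrite pu /cut_pos /= xpair_eqE eqxx /= addnK.
      by split; [lia | case: ltnP => //; lia].
    case: (onto i j jn) => u pu; exists u; rewrite pu /cut_pos /= xpair_eqE.
    by rewrite (negbTE im).
  case: pu => nu pu.
  have uv : u \in [set~ v] by rewrite !inE; apply: contraNneq nu => ->; rewrite pv.
  by exists (Sub u uv).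
- move=> u w; rewrite /= /induced_edge edge.
  have := neq u; have := neq w; have := lt_l (val u); have := lt_l (val w).
  rewrite /cut_pos /adjacent_pos.
  case: (p (val u)) (p (val w)) => [i j] [i' j'] /=; rewrite !xpair_eqE.
  by case: ifP; case: ifP => /=; lia.
Qed.

Lemma full_hom_induced (G H : sgraph) (A B : {set G}) :
  A \subset B -> full_hom (induced B) H -> full_hom (induced A) H.
Proof.
move=> /subsetP AB [f hf].
by exists (fun u => f (Sub (val u) (AB _ (valP u)))) => u v; rewrite -hf.
Qed.

(** A twin of a remaining vertex can be sent to the image of that vertex, so that
    a full homomorphism survives putting back a deleted twin. *)
Lemma minimal_obstruction_twin_free (G H : sgraph) (u v : G) :
  minimal_obstruction H G -> (forall w, sedge u w = sedge v w) -> u = v.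
Proof.
case=> nhom hmin tw; apply/eqP/negPn/negP => uv; apply: nhom.
have [|f hf] := hmin [set~ v].
  by rewrite properT; apply/eqP => /setP/(_ v); rewrite !inE eqxx.
have uin : u \in [set~ v] by rewrite !inE.
have rin w : (if w == v then u else w) \in [set~ v].
  by case: eqP => // /eqP wv; rewrite !inE.
exists (fun w => f (Sub (if w == v then u else w) (rin w))) => x y.
rewrite -hf /= /induced_edge /=.
have tw1 z t : sedge (if z == v then u else z) t = sedge z t.
  by case: eqP => // ->; rewrite tw.
by rewrite tw1 ![sedge x _]sedge_sym tw1.
Qed.

(** Restriction preserves full homomorphisms, so that it is enough to delete one
    vertex at a time. *)
Lemma minimal_obstruction_layout s (G H : sgraph) (p : G -> nat * nat) :
  layout s p -> ~ full_hom G H ->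
  (forall s1 s2 a b (G' : sgraph) (p' : G' -> nat * nat),
     s = s1 ++ (a + b).+1 :: s2 -> layout (rcons (s1 ++ a :: s2) b) p' ->
     full_hom G' H) ->
  minimal_obstruction H G.
Proof.
move=> lay nhom hdel; split=> // A; rewrite properT => nA.
have [v vA] : exists v, v \notin A.
  apply/existsP; rewrite -negb_forall; apply: contra nA => /forallP h.
  by apply/eqP/setP => x; rewrite h inE.
have sub : A \subset [set~ v].
  by apply/subsetP => x xA; rewrite !inE; apply: contraNneq vA => <-.
apply: full_hom_induced sub _.
have := layout_lt lay v; case pv: (p v) => [i a] /= ai.
have is_ := nth_gt_size ai.
have sE : s = take i s ++ (a + (nth 0 s i - a.+1)).+1 :: drop i.+1 s.
  by rewrite -addSn subnKC // -drop_nth // cat_take_drop.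
apply: (hdel _ _ _ _ _ _ sE); rewrite sE in lay.
by apply: layout_delete lay _; rewrite pv size_take is_.
Qed.

(** * The spine budget is necessary *)

(** The number of spine vertices blocked by a path on [n] vertices: those that it
    uses and one separator.  An edge uses one, a longer path uses all but its two
    ends, and an isolated vertex uses none. *)
Definition path_cost (n : nat) : nat := n.-1 + (n == 2).

Definition total_cost (s : seq nat) : nat := sumn (map path_cost s).

(** The union of [A] and its translate by one, inside an interval that is longer
    by one: the separator after each used spine vertex is counted with it, even
    at the right end of the spine. *)
Definition shadow k (A : {set 'I_k}) : {set 'I_k.+1} :=
  [set lift ord_max t | t in A] :|: [set lift ord0 t | t in A].

(** The successor of the maximum of [A] is a new element. *)
Lemma card_shadow k (A : {set 'I_k}) : A != set0 -> #|A| < #|shadow A|.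
Proof.
case/set0Pn => t0 t0A; rewrite -(card_imset A (@lift_inj _ ord_max)).
apply/proper_card/properP; split; first exact: subsetUl.
case: (arg_maxnP (P := mem A) (fun t : 'I_k => nat_of_ord t) t0A) => t tA tmax.
exists (lift ord0 t); first by apply/setUP; right; apply: imset_f.
apply/imsetP => -[u /tmax uA /(congr1 val)] /=.
by rewrite /bump /= leqNgt ltn_ord; lia.
Qed.

Lemma mem_shadow k (A : {set 'I_k}) (t : 'I_k.+1) :
  t \in shadow A -> exists2 u, u \in A & (t == u :> nat) || (t == u.+1 :> nat).
Proof.
case/setUP => /imsetP[u uA ->]; exists u => //=; rewrite /bump /=.
  by rewrite leqNgt ltn_ord eqxx.
by rewrite add1n eqxx orbT.
Qed.

Lemma total_costE s : total_cost s = \sum_(i < size s) path_cost (nth 0 s i).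
Proof. by rewrite /total_cost sumnE big_map (big_nth 0) big_mkord. Qed.

Section Footprint.
Variables (k : nat) (s : seq nat) (G : sgraph) (p : G -> nat * nat).
Variable f : G -> centipede k.
Hypothesis lay : layout s p.
Hypothesis hf : forall u v : G, sedge u v <-> sedge (f u) (f v).

Definition footprint (i : nat) : {set 'I_k} :=
  [set t | [exists u : G, ((p u).1 == i) && (f u == inl t :> ('I_k + 'I_k)%type)]].

Lemma full_hom_edge u v : sedge (f u) (f v) = sedge u v.
Proof. by apply/idP/idP => /hf. Qed.

Lemma nontrivial_neighbour u :
  1 < nth 0 s (p u).1 -> exists w, sedge u w.
Proof.
have := layout_lt lay u; case pu : (p u) => [i [|j]] /= ju n1.
  case: (layout_onto lay n1) => w pw; exists w.
  by rewrite (layout_edge lay) pu pw /adjacent_pos /= !eqxx.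
case: (layout_onto lay (ltnW ju)) => w pw; exists w.
by rewrite (layout_edge lay) pu pw /adjacent_pos /= !eqxx orbT.
Qed.

(** If spine vertices met by two paths are adjacent, so are preimages of them; if
    they coincide, a neighbour of one preimage is a neighbour of the other.
    Either way the two paths are connected. *)
Lemma footprints_apart i j (t u : 'I_k) :
  1 < nth 0 s i -> t \in footprint i -> u \in footprint j ->
  (t <= u.+1) && (u <= t.+1) -> i = j.
Proof.
move=> ni; rewrite !inE => /existsP[x /andP[/eqP xi /eqP fx]].
move=> /existsP[y /andP[/eqP yj /eqP fy]] near.
suff [w] : exists w, ((p w).1 == i) && ((p w).1 == j).
  by case/andP => /eqP <- /eqP.
have edge1 v w : sedge v w -> (p v).1 = (p w).1.
  by rewrite (layout_edge lay) => /andP[/eqP].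
case: (eqVneq (t : nat) u) => tu; last first.
  exists x; rewrite xi eqxx /=; have : sedge (f x) (f y).
    by rewrite fx fy /= /path_edge; lia.
  by rewrite full_hom_edge => /edge1; rewrite xi yj => ->.
have [|w xw] := @nontrivial_neighbour x; first by rewrite xi.
exists x; rewrite xi eqxx /=; have : sedge y w.
  by rewrite -full_hom_edge fy -(val_inj tu) -fx full_hom_edge.
by move/edge1; rewrite -(edge1 _ _ xw) xi yj => ->.
Qed.

(** An edge always meets the spine, which settles the paths on at most 3 vertices.
    On a longer path no inner vertex can be sent to a leaf, for its two neighbours
    would then have the same image although they are not twins, and inner vertices
    have distinct images for the same reason. *)
Lemma card_footprint i : 1 < nth 0 s i -> path_cost (nth 0 s i) <= #|footprint i|.+1.
Proof.
set n := nth 0 s i => n1.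
have /fin_all_exists [v pv] : forall j : 'I_n, exists u, p u = (i, nat_of_ord j).
  by move=> j; apply: (layout_onto lay).
have adj (a b : 'I_n) :
    sedge (f (v a)) (f (v b)) = (a.+1 == b) || (b.+1 == a).
  by rewrite full_hom_edge (layout_edge lay) !pv /adjacent_pos /= eqxx.
have spine (a : 'I_n) t : f (v a) = inl t -> t \in footprint i.
  by move=> e; rewrite inE; apply/existsP; exists (v a); rewrite pv e /= !eqxx.
have ne0 : 0 < #|footprint i|.
  have := adj (Ordinal (ltnW n1)) (Ordinal n1); rewrite /=.
  case fa : (f (v (Ordinal (ltnW n1)))) => [t|t].
    by move=> _; rewrite (cardD1 t) (spine _ _ fa).
  case fb : (f (v (Ordinal n1))) => [t'|t'] //= _.
  by rewrite (cardD1 t') (spine _ _ fb).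
case: (leqP n 3) => n3; first by rewrite /path_cost; lia.
have lt1 (j : 'I_(n - 2)) : j.+1 < n by have := ltn_ord j; lia.
have inner (j : 'I_(n - 2)) : exists t, f (v (Ordinal (lt1 j))) = inl t.
  case fj : (f (v (Ordinal (lt1 j)))) => [t|t]; first by exists t.
  have j0 : j < n by have := ltn_ord j; lia.
  have j2 : j.+2 < n by have := ltn_ord j; lia.
  have := adj (Ordinal (lt1 j)) (Ordinal j0); rewrite fj /= eqxx orbT.
  case f0 : (f (v (Ordinal j0))) => [t0|//] /eqP tt0.
  have := adj (Ordinal (lt1 j)) (Ordinal j2); rewrite fj /= eqxx.
  case f2 : (f (v (Ordinal j2))) => [t2|//] /eqP tt2.
  have tw c : sedge (f (v (Ordinal j0))) (f (v c)) =
      sedge (f (v (Ordinal j2))) (f (v c)) by rewrite f0 f2 -tt0 -tt2.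
  (* Positions [j] and [j + 2] would be twins, but position [j + 3] tells them
     apart if the path reaches that far, and position [j - 1] otherwise. *)
  case: (ltnP j.+3 n) => j3.
    by have := tw (Ordinal j3); rewrite !adj /=; lia.
  have j1 : j.-1 < n by lia.
  by have := tw (Ordinal j1); rewrite !adj /=; lia.
case/fin_all_exists: inner => g gE.
have ginj : injective g.
  have mono (a b : 'I_(n - 2)) : a < b -> g a <> g b.
    move=> ab e; have a0 : a < n by have := ltn_ord a; lia.
    have := adj (Ordinal a0) (Ordinal (lt1 a)).
    have := adj (Ordinal a0) (Ordinal (lt1 b)).
    by rewrite !gE e /= => ->; lia.
  move=> a b e; apply/val_inj; case: (ltngtP a b) => // /mono; first by case.
  by rewrite e.
have : #|[set g j | j in [set: 'I_(n - 2)]]| <= #|footprint i|.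
  by apply/subset_leq_card/subsetP => t /imsetP[j _ ->]; apply: spine (gE j).
by rewrite card_imset // cardsT card_ord /path_cost; lia.
Qed.

(** The shadows of the footprints of the different paths are disjoint subsets of a
    set with [k + 1] elements. *)
Lemma full_hom_total_cost : total_cost s <= k.+1.
Proof.
pose S i := if 1 < nth 0 s i then shadow (footprint i) else set0.
apply: (@leq_trans (\sum_(i < size s) #|S i|)).
  rewrite total_costE; apply: leq_sum => i _; rewrite /S; case: ifP => n1.
    have := card_footprint n1; case: (eqVneq (footprint i) set0) => [->|].
      have := n1; rewrite cards0 /path_cost; lia.
    by move/card_shadow; lia.
  by rewrite /path_cost; lia.
under eq_bigr => i _ do rewrite -sum1_card big_mkcond.
rewrite exchange_big /= -[leqRHS]card_ord -sum1_card.
apply: leq_sum => t _; rewrite -big_mkcond /= sum1_card.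
rewrite (eq_card (B := [pred i : 'I_(size s) | t \in S i])) //.
have memS (i : 'I_(size s)) : t \in S i ->
    1 < nth 0 s i /\ exists2 u, u \in footprint i & (t == u :> nat) || (t == u.+1 :> nat).
  by rewrite /S; case: ifP => [n1 /mem_shadow|]; rewrite ?in_set0.
apply/card_le1_eqP => i j; rewrite !inE.
move=> /memS[ni [a aA ta]] /memS[nj [b bA tb]].
by apply/val_inj/(footprints_apart nj bA aA); lia.
Qed.

End Footprint.

(** * The spine budget is sufficient *)

Definition offset (s : seq nat) (i : nat) : nat := total_cost (take i s).

Lemma total_cost_cat s1 s2 : total_cost (s1 ++ s2) = total_cost s1 + total_cost s2.
Proof. by rewrite /total_cost map_cat sumn_cat. Qed.

Lemma offsetS s i : offset s i.+1 = offset s i + path_cost (nth 0 s i).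
Proof.
rewrite /offset; case: (ltnP i (size s)) => h.
  by rewrite (take_nth 0) // -cats1 total_cost_cat /total_cost /= addn0.
by rewrite !take_oversize ?nth_default ?addn0 // ltnW.
Qed.

Lemma offset_homo s : {homo offset s : i j / i <= j}.
Proof.
apply: homo_leq => [//|? ? ?|i]; first exact: leq_trans.
by rewrite offsetS leq_addr.
Qed.

Lemma offset_total s i : offset s i <= total_cost s.
Proof.
by rewrite -[total_cost s](congr1 total_cost (cat_take_drop i s)) total_cost_cat leq_addr.
Qed.

Lemma offset_size s : offset s (size s) = total_cost s.
Proof. by rewrite /offset take_size. Qed.

(** The separator after the first path of positive price is a free column: later
    paths start beyond it, and it lies on the spine since no path fills the spine
    on its own. *)
Lemma free_column s k : 0 < k -> total_cost s <= k.+1 ->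
  all (fun n => path_cost n <= k) s ->
  exists2 x, x < k & forall i, 1 < nth 0 s i ->
    (x < offset s i) || ((offset s i + path_cost (nth 0 s i)) <= x.+1).
Proof.
move=> k0 tk small; case: (posnP (total_cost s)) => t0.
  exists 0 => // i n1; have := offset_total s i.+1; rewrite offsetS t0.
  by move: n1; rewrite /path_cost; lia.
have ex : exists i, 0 < offset s i by exists (size s); rewrite offset_size.
case: (ex_minnP ex) => -[|m] om mmin; first by rewrite /offset take0 in om.
have o0 : offset s m = 0.
  by apply/eqP; rewrite -leqn0 leqNgt; apply/negP => /mmin; rewrite ltnn.
have cm : path_cost (nth 0 s m) <= k.
  case: (ltnP m (size s)) => h; first exact: (all_nthP 0 small).
  by rewrite nth_default.
move: om; rewrite offsetS o0 add0n => om.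
(* Column [offset s m.+1 - 1] separates path [m] from the later ones. *)
exists (path_cost (nth 0 s m)).-1; first by lia.
move=> i _; case: (ltnP m i) => mi.
  by have := offset_homo s mi; rewrite offsetS o0; lia.
by rewrite -ltnS in mi; have := offset_homo s mi; rewrite !offsetS o0; lia.
Qed.

(** Each path starts at the column following the separator of the previous one and
    runs along the spine.  An edge consists of a spine vertex and its leaf; a longer
    path has its two ends on the leaves of its first and last columns.  All the
    isolated vertices share the leaf of one free column. *)
Lemma full_hom_centipede k s (G : sgraph) (p : G -> nat * nat) :
  layout s p -> 0 < k -> total_cost s <= k.+1 ->
  1 \notin s \/ all (fun n => path_cost n <= k) s -> full_hom G (centipede k).
Proof.
case: k => // k lay _ tk hs.
have [x xk xfree] : exists2 x, x <= k & 1 \in s -> forall i, 1 < nth 0 s i ->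
    (x < offset s i) || ((offset s i + path_cost (nth 0 s i)) <= x.+1).
  case: hs => [/negbTE-> | hs]; first by exists 0.
  by have [x xk xfree] := free_column (ltn0Sn k) tk hs; exists x.
pose trivial u := nth 0 s (p u).1 <= 1.
pose len u := nth 0 s (p u).1.
pose leaf u := [|| len u <= 1, (p u).2 == 0 | (2 < len u) && ((p u).2.+1 == len u)].
(* For [P_3] the last column is the first one, so that the two twins share a
   leaf; the last vertex of an edge stays on the spine. *)
pose col u := if len u <= 1 then x else
  offset s (p u).1 + (if (p u).2 == 0 then 0 else
    if (2 < len u) && ((p u).2.+1 == len u) then len u - 3 else (p u).2.-1).
have bound u : 1 < len u ->
    offset s (p u).1 <= col u /\ (col u).+2 <= offset s (p u).1 + path_cost (len u).
  move=> n1; have := layout_lt lay u; rewrite /col (leqNgt (len u)) n1 /= -/(len u).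
  by rewrite /path_cost; case: ifP => ?; [|case: ifP => ?]; lia.
have colk u : col u <= k.
  case: (leqP (len u) 1) => n1; first by rewrite /col n1.
  have [_] := bound u n1; have := offset_total s (p u).1.+1; rewrite offsetS -/(len u).
  by move: tk; lia.
exists (fun u => if leaf u then inr (inord (col u)) else inl (inord (col u))) => u v.
have -> : sedge u v = [&& ~~ (leaf u && leaf v)
   & if leaf u || leaf v then col u == col v
     else ((col u).+1 == col v) || ((col v).+1 == col u)]; last first.
  have E w : nat_of_ord (inord (col w) : 'I_k.+1) = col w by rewrite inordK // ltnS.
  by case: (leaf u) (leaf v) => -[]; rewrite /= /path_edge -?val_eqE /= ?E.
rewrite (layout_edge lay) /adjacent_pos.
have lone w : len w <= 1 -> 1 \in s /\ (p w).2 = 0.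
  have := layout_lt lay w; rewrite -/(len w) => lw w1.
  have w1' : len w = 1 by lia.
  split; last by lia.
  by rewrite -w1' mem_nth // (nth_gt_size lw).
have apart w z : (p w).1 < (p z).1 ->
  offset s (p w).1 + path_cost (len w) <= offset s (p z).1.
  by move/(offset_homo s); rewrite offsetS.
have free w z : len w <= 1 -> 1 < len z -> col w != col z.
  move=> w1 z1; have [c1 c2] := bound z z1; have [s1 _] := lone w w1.
  have := xfree s1 _ z1; rewrite -/(len z).
  by have -> : col w = x; [rewrite /col w1 | lia].
case: (leqP (len u) 1) => u1; case: (leqP (len v) 1) => v1.
- rewrite /leaf u1 v1 /=; have [_ ->] := lone u u1; have [_ ->] := lone v v1.
  by rewrite /= andbF.
- have -> : leaf u by rewrite /leaf u1.
  have /negbTE-> : (p u).1 != (p v).1.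
    by apply: contraTneq v1 => e; rewrite -leqNgt /len -e.
  by rewrite /= (negbTE (free u v u1 v1)) andbF.
- have -> : leaf v by rewrite /leaf v1.
  have /negbTE-> : (p u).1 != (p v).1.
    by apply: contraTneq u1 => e; rewrite -leqNgt /len e.
  by rewrite orbT /= eq_sym (negbTE (free v u v1 u1)) andbF.
case: (ltngtP (p u).1 (p v).1) => e /=.
- have := apart u v e; have [? ?] := bound u u1; have [? ?] := bound v v1.
  by case: (leaf u) (leaf v) => -[] /=; lia.
- have := apart v u e; have [? ?] := bound u u1; have [? ?] := bound v v1.
  by case: (leaf u) (leaf v) => -[] /=; lia.
have := layout_lt lay u; have := layout_lt lay v; rewrite -/(len u) -/(len v).
have lE : len u = len v by rewrite /len e.
rewrite /leaf /col e lE [len v <= 1]leqNgt v1 /=.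
move: (p u).2 (p v).2 (len v) v1 (offset s (p v).1) => a b n n1 o bn an.
case: (ltngtP 2 n) => n2 /=; [| lia |].
  by repeat case: eqP => ? /=; lia.
by repeat case: eqP => ? /=; lia.
Qed.

(** * Path lengths in a minimal obstruction *)

Lemma total_cost_cons n s : total_cost (n :: s) = path_cost n + total_cost s.
Proof. by []. Qed.

Lemma total_cost_delete s1 s2 a b :
  total_cost (rcons (s1 ++ a :: s2) b) =
  total_cost (s1 ++ s2) + path_cost a + path_cost b.
Proof.
by rewrite -cats1 !total_cost_cat /total_cost /=; lia.
Qed.

Lemma total_cost_mid s1 n s2 :
  total_cost (s1 ++ n :: s2) = total_cost (s1 ++ s2) + path_cost n.
Proof. by rewrite !total_cost_cat total_cost_cons; lia. Qed.

Lemma minimal_obstruction_cut k s1 s2 a b (G : sgraph) (p : G -> nat * nat) :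
  layout (s1 ++ (a + b).+1 :: s2) p -> minimal_obstruction (centipede k) G ->
  total_cost (s1 ++ s2) + path_cost a + path_cost b <= k.+1.
Proof.
move=> lay [_ hmin].
have [|v pv] := layout_onto lay (i := size s1) (j := a).
  by rewrite nth_cat ltnn subnn /= ltnS leq_addr.
have [|f hf] := hmin [set~ v].
  by rewrite properT; apply/eqP => /setP/(_ v); rewrite !inE eqxx.
rewrite -total_cost_delete.
exact: full_hom_total_cost (layout_delete lay pv) hf.
Qed.

Lemma count_le1 (T : eqType) (x0 x : T) (s : seq T) :
  x != x0 -> (forall i j, nth x0 s i = x -> nth x0 s j = x -> i = j) ->
  count_mem x s <= 1.
Proof.
move=> nx; elim: s => //= y s IH inj; case: eqP => [yx|_]; last first.
  by apply: IH => i j hi hj; have [] := inj i.+1 j.+1 hi hj.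
rewrite (_ : count_mem x s = 0) //; apply/count_memPn/negP => xs.
by have := inj 0 (index x s).+1 yx (nth_index _ xs).
Qed.

(** Isolated vertices are twins of each other. *)
Lemma isolated_le1 H s (G : sgraph) (p : G -> nat * nat) :
  layout s p -> minimal_obstruction H G -> count_mem 1 s <= 1.
Proof.
move=> lay hmin; apply: (@count_le1 _ 0) => // i j ni nj.
have [|u pu] := layout_onto lay (i := i) (j := 0); first by rewrite ni.
have [|v pv] := layout_onto lay (i := j) (j := 0); first by rewrite nj.
have iso w i' : p w = (i', 0) -> nth 0 s i' = 1 -> forall z, sedge w z = false.
  move=> pw n1 z; rewrite (layout_edge lay) pw /adjacent_pos /=.
  by have := layout_lt lay z; case: eqP => //= <-; rewrite n1; lia.
have uv : u = v.
  by apply: minimal_obstruction_twin_free hmin _ => w; rewrite (iso u i) ?(iso v j).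
by move: pu; rewrite uv pv => -[].
Qed.

(** An isolated vertex is free, an edge costs 2 and any longer path costs one less
    than its order. *)
Lemma sumn_total_cost s :
  sumn s = total_cost s + count_mem 1 s + count (leq 3) s.
Proof.
elim: s => //= n s ->; rewrite total_cost_cons /path_cost.
by case: n => [|[|[|n]]] /=; lia.
Qed.

Lemma count_long s : 2 * count (leq 3) s <= total_cost s.
Proof.
elim: s => //= n s; rewrite total_cost_cons /path_cost.
by case: n => [|[|[|n]]] /=; lia.
Qed.

(** The first two cases are the forests that exceed the budget, the second one
    consisting of edges only; the third is an isolated vertex together with a path
    on [k + 2] vertices. *)
Lemma minimal_obstruction_lengths k s (G : sgraph) (p : G -> nat * nat) :
  3 <= k -> layout s p -> minimal_obstruction (centipede k) G ->
  [\/ total_cost s = k.+2 /\ all (fun n => n \notin [:: 1; 3; 5]) s,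
      k.+2 <= total_cost s <= k.+3 /\ all (fun n => n \in [:: 0; 2]) s
    | sumn s = k.+3].
Proof.
move=> k3 lay hmin; have [nhom _] := hmin.
have cut n a b : n \in s -> (a + b).+1 = n ->
    total_cost s + path_cost a + path_cost b <= k.+1 + path_cost n.
  move=> ns nE; case/splitPr: ns lay => s1 s2 lay; rewrite -nE in lay.
  by have := minimal_obstruction_cut lay hmin; rewrite total_cost_mid; lia.
case: (leqP k.+2 (total_cost s)) => tk.
  have no135 : all (fun n => n \notin [:: 1; 3; 5]) s.
    apply/allP => n ns; rewrite !inE; apply/negP => /or3P[]/eqP nE; rewrite nE in ns.
    - by have := cut _ 0 0 ns erefl; rewrite /path_cost /=; lia.
    - by have := cut _ 0 2 ns erefl; rewrite /path_cost /=; lia.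
    - by have := cut _ 2 2 ns erefl; rewrite /path_cost /=; lia.
  case: (boolP (all (fun n => n \in [:: 0; 2]) s)) => [all02|].
    apply: Or32; split => //=.
    have [n ns n0] : exists2 n, n \in s & n != 0.
      apply/hasP; rewrite has_predC; apply: contraTN tk => /all_pred1P->.
      by rewrite /total_cost map_nseq sumn_nseq.
    have := allP all02 n ns; rewrite !inE (negbTE n0) /= => /eqP n2.
    by rewrite n2 in ns; have := cut _ 0 1 ns erefl; rewrite /path_cost /=; lia.
  case/allPn => n ns n02; apply: Or31; split=> //.
  have := allP no135 n ns; move: n02; rewrite !inE => n02 n135.
  have := cut n 0 n.-1 ns; rewrite /path_cost /=; lia.
apply: Or33.
have : ~ (1 \notin s \/ all (fun n => path_cost n <= k) s).
  by move=> h; apply/nhom/(full_hom_centipede lay) => //; lia.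
case: (boolP (1 \in s)) => [s1 h|s1 []]; last by left.
have {h} /allPn [n ns nk] : ~~ all (fun n => path_cost n <= k) s.
  by apply/negP => small; apply: h; right.
have c1 := isolated_le1 lay hmin; rewrite -has_pred1 has_count in s1.
rewrite sumn_total_cost; move: tk c1 s1.
case/splitPr: ns => t1 t2; rewrite total_cost_mid !count_cat /= => tk c1 s1.
have := count_long (t1 ++ t2); rewrite count_cat.
move: nk tk c1 s1; rewrite /path_cost /=; lia.
Qed.

(** * Bounds on the order *)

(** Without [P_3] and [P_5], a path on at least 3 vertices costs 3, if it is [P_4],
    or at least 5; an edge costs 2.  So the excess over 3 per long path is never 1:
    this is what distinguishes the three residues of [k] modulo 3. *)
Lemma count_no35 s : all (fun n => n \notin [:: 1; 3; 5]) s ->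
  total_cost s = 3 * count (leq 3) s \/ 3 * count (leq 3) s + 2 <= total_cost s.
Proof.
elim: s => [|n s IH] /=; first by left.
case/andP; rewrite !inE => n135 /IH; rewrite total_cost_cons /path_cost.
by case: n n135 => [|[|[|n]]] /=; lia.
Qed.

Lemma total_even s : all (fun n => n \in [:: 0; 2]) s ->
  sumn s = total_cost s /\ ~~ odd (sumn s).
Proof.
elim: s => [|n s IH] //= /andP[]; rewrite !inE => n02 /IH[sE sev].
rewrite total_cost_cons /path_cost; case/orP: n02 => /eqP -> /=; split; lia.
Qed.

Lemma no_long s : count (leq 3) s = 0 -> all (fun n => n \notin [:: 1; 3; 5]) s ->
  all (fun n => n \in [:: 0; 2]) s.
Proof.
elim: s => [|n s IH] //= h /andP[]; rewrite !inE => n1 /IH -> //; last by lia.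
by rewrite andbT; move: h n1; case: n => [|[|[|n]]] /=; lia.
Qed.

(** The order is at least the price, hence at least [k + 2]; equality forces the
    forest to consist of edges and [k] to be even. *)
Lemma minimal_obstruction_order_min k (G : sgraph) :
  3 <= k -> linear_forest_minimal_obstruction (centipede k) G ->
  2 * (uphalf k + 1) <= #|G|.
Proof.
move=> k3 [/linear_forest_layout[s [p lay]] hmin]; rewrite (card_layout lay).
have uk : uphalf k = k./2 + odd k by rewrite uphalf_half addnC.
have kE := odd_double_half k.
case: (minimal_obstruction_lengths k3 lay hmin) => [[tk no135]|[tk /total_even[]]|->].
- case: (posnP (count (leq 3) s)) => [c0|c0].
    by have [sE sev] := total_even (no_long c0 no135); move: sev; rewrite sE tk; lia.
  by rewrite sumn_total_cost tk; lia.
- by lia.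
- by lia.
Qed.

(** When the price is [k + 2], the witness [c] is the number of paths on at least 4
    vertices, and the order is [k + 2 + c]; in the remaining cases the order is at
    most [k + 3]. *)
Lemma minimal_obstruction_order_max k (G : sgraph) :
  3 <= k -> linear_forest_minimal_obstruction (centipede k) G ->
  exists2 c, #|G| <= maxn k.+3 (k.+2 + c) & 3 * c = k.+2 \/ 3 * c + 2 <= k.+2.
Proof.
move=> k3 [/linear_forest_layout[s [p lay]] hmin]; rewrite (card_layout lay).
case: (minimal_obstruction_lengths k3 lay hmin) => [[tk no135]|[tk /total_even[]]|->].
- exists (count (leq 3) s); last by have := count_no35 no135; rewrite tk; lia.
  rewrite sumn_total_cost (count_memPn _) ?addn0 ?tk ?leq_maxr //.
  by apply/negP => /(allP no135).
- by exists 0; lia.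
- by exists 0; lia.
Qed.

(** * Extremal obstructions *)

(** Deleting a vertex lowers the price by 2 for an edge and by 1 for [P_4], whence
    the slack of 1 when there are only edges.  No path of length 2 or 4 fills the
    spine, as [k >= 3]: the isolated vertices left by deletions find room. *)
Lemma layout24_obstruction k s (G : sgraph) (p : G -> nat * nat) :
  3 <= k -> layout s p -> all (fun n => n \in [:: 2; 4]) s ->
  k.+2 <= total_cost s <= k.+2 + (4 \notin s) ->
  linear_forest_minimal_obstruction (centipede k) G.
Proof.
move=> k3 lay all24 /andP[tlo thi]; split; first exact: layout_linear_forest lay.
apply: (minimal_obstruction_layout lay) => [[f hf]|s1 s2 a b G' p' sE lay'].
  by have := full_hom_total_cost lay hf; lia.
have ab : (a + b).+1 \in [:: 2; 4].
  by apply: (allP all24); rewrite sE mem_cat inE eqxx orbT.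
apply: (full_hom_centipede lay'); first by lia.
  move: thi; rewrite total_cost_delete sE total_cost_mid mem_cat inE.
  by move: ab; rewrite !inE /path_cost => /orP[]/eqP e; case: (4 \in s1); lia.
right; rewrite -cats1 !all_cat /= andbT.
have small n : n \in [:: 2; 4] -> path_cost n <= k.
  by rewrite !inE /path_cost => /orP[]/eqP->; lia.
move: all24; rewrite sE all_cat /= => /and3P[/(sub_all small)-> _ /(sub_all small)->].
by move: ab; rewrite !inE /path_cost; lia.
Qed.

Lemma total_cost_nseq r n : total_cost (nseq r n) = path_cost n * r.
Proof. by rewrite /total_cost map_nseq sumn_nseq. Qed.

Theorem proposition17 (k : nat) (hk : 3 <= k) :
  [/\ minimum_order_linear_forest_minimal_obstruction (centipede k)
        (copies (uphalf k + 1) (complete_graph 2)),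
      forall r : nat, k = 3 * r ->
        maximum_order_linear_forest_minimal_obstruction (centipede k)
          (disjoint_union (copies r (path_graph 4)) (complete_graph 2)),
      forall r : nat, k = 3 * r + 1 ->
        maximum_order_linear_forest_minimal_obstruction (centipede k)
          (copies (r + 1) (path_graph 4))
    & forall r : nat, k = 3 * r + 2 ->
        maximum_order_linear_forest_minimal_obstruction (centipede k)
          (disjoint_union (copies r (path_graph 4))
             (copies 2 (complete_graph 2)))].
Proof.
have K2 m := layout_copies m layout_complete2.
have P4 m := layout_copies m (layout_path 4).
have all24 m n : n \in [:: 2; 4] -> all (fun n => n \in [:: 2; 4]) (nseq m n).
  by move=> n24; rewrite all_nseq n24 orbT.
split=> [|r kE|r kE|r kE].
- have uk : uphalf k = k./2 + odd k by rewrite uphalf_half addnC.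
  have k2 := odd_double_half k.
  split.
    apply: (layout24_obstruction hk (K2 _)); first exact: all24.
    by rewrite total_cost_nseq mem_nseq andbF /path_cost /=; lia.
  move=> G' /(minimal_obstruction_order_min hk).
  by rewrite (card_layout (K2 _)) sumn_nseq.
- have lay := layout_disjoint_union (P4 r) layout_complete2.
  split.
    apply: (layout24_obstruction hk lay); first by rewrite all_cat all24.
    by rewrite total_cost_cat total_cost_nseq /total_cost /path_cost /=; lia.
  move=> G' /(minimal_obstruction_order_max hk)[c].
  by rewrite (card_layout lay) sumn_cat sumn_nseq /=; lia.
- split.
    apply: (layout24_obstruction hk (P4 _)); first exact: all24.
    by rewrite total_cost_nseq /path_cost /=; lia.
  move=> G' /(minimal_obstruction_order_max hk)[c].
  by rewrite (card_layout (P4 _)) sumn_nseq; lia.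
- have lay := layout_disjoint_union (P4 r) (K2 2).
  split.
    apply: (layout24_obstruction hk lay); first by rewrite all_cat !all24.
    by rewrite total_cost_cat !total_cost_nseq /path_cost /=; lia.
  move=> G' /(minimal_obstruction_order_max hk)[c].
  by rewrite (card_layout lay) sumn_cat !sumn_nseq /=; lia.
Qed.
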